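(* If the distribution of $Z$ is such that there exists $\lambda>0$ with $\sum_{n=1}^\infty p_n^\lambda<\infty$, then the root degrees $\{D^{(i)}\}_{i<0}$ form a tight sequence of random variables. In particular, for all $x\ge\lambda$, $$\mathbb{P}\left\{\max_{i<0}D^{(i)}>x\right\}\le\left(\frac{e}{x}\right)^x\sum_{n=1}^\infty p_n^x.$$
   Context: $\mathbb{N}=\{1,2,\ldots\}$. Let $Z,Z_1,Z_2,\ldots$ be independent, identically distributed random variables taking values in $\mathbb{N}$; write $p_n=\mathbb{P}\{Z\ge n\}$ for $n\in\mathbb{N}$. In the subtractive random forest on vertex set $\mathbb{Z}$, integers $i\le 0$ are roots and each $n\in\mathbb{N}$ is attached to its parent $n-Z_n$. The (out)degree of an integer $i$ in the final forest is $D^{(i)}=\sum_{t=\max(1,i+1)}^\infty\mathbf{1}_{\{Z_t=t-i\}}$, the number of $t\in\mathbb{N}$ whose parent is $i$. *)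

(* Defs.v *)
From HB Require Import structures.
From mathcomp Require Import all_boot all_order all_algebra.
From mathcomp Require Import all_classical all_reals all_analysis.
From mathcomp Require Import measurable_realfun.

Set Implicit Arguments.
Unset Strict Implicit.
Unset Printing Implicit Defensive.

Import Order.TTheory GRing.Theory Num.Theory.
Import numFieldNormedType.Exports.

Local Open Scope classical_set_scope.
Local Open Scope ring_scope.
Local Open Scope ereal_scope.

Section probability_notions.
Context {d d' : measure_display} {T : measurableType d}
  {S : measurableType d'} {R : realType} (P : probability T R).

Definition mutually_independent (I : eqType) (X : I -> {RV P >-> S}) : Prop :=
  forall (s : seq I) (A : I -> set S), uniq s ->
    (forall i, measurable (A i)) ->
    P (\bigcap_(i in [set` s]) (X i @^-1` A i)) =
    \prod_(i <- s) P (X i @^-1` A i).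

Definition identically_distributed (I : Type) (X : I -> {RV P >-> S}) : Prop :=
  forall (i j : I) (A : set S), measurable A ->
    distribution P (X i) A = distribution P (X j) A.

Definition iid (I : eqType) (X : I -> {RV P >-> S}) : Prop :=
  mutually_independent X /\ identically_distributed X.

(* Tightness in the real line: as the variables are allowed to take infinite
   values, the condition also makes these values negligible. *)
Definition tight (I : Type) (D : set I) (X : I -> T -> \bar R) : Prop :=
  forall e : R, (0 < e)%R -> exists M : R,
    forall i, D i -> P [set w | M%:E < `|X i w|] <= e%:E.

End probability_notions.

Section subtractive_random_forest.
Context {d : measure_display} {T : measurableType d} {R : realType}
  (P : probability T R).

(* Z 0 is the generic copy of the step variable (usually written without
   an index); it is not used by the forest. Z 1, Z 2, ... are the steps
   of the vertices 1, 2, ... *)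
Context (Z : nat -> {RV P >-> nat}).

Definition tail_prob (n : nat) : \bar R := P [set w | (n <= Z 0%N w)%N].

Definition parent (w : T) (n : nat) : int := (n%:Z - (Z n w)%:Z)%R.

(* The degree may a priori be infinite, whence the values in \bar R.
   The lower bound is the positive integer max(1, i + 1), cast to nat. *)
Definition outdegree (i : int) (w : T) : \bar R :=
  \sum_(absz (Num.max 1 (i + 1))%R <= t <oo) (parent w t == i)%:R%:E.

Lemma measurable_outdegree (i : int) : measurable_fun setT (outdegree i).
Proof.
rewrite /outdegree; under eq_fun do rewrite eseries_cond.
apply: ge0_emeasurable_sum => [k w _ _|k _]; first by rewrite lee_fin ler0n.
apply: (@measurableT_comp _ _ _ _ _ _
    (fun n : nat => ((k%:Z - n%:Z)%R == i)%:R%:E)).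
  by move=> _ B _; rewrite setTI.
exact: measurable_funPT.
Qed.

End subtractive_random_forest.

(* Main.v *)
Require Import Defs.
From HB Require Import structures.
From mathcomp Require Import all_boot all_order all_algebra.
From mathcomp Require Import all_classical all_reals all_analysis.
From mathcomp Require Import measurable_realfun lra zify.

Set Implicit Arguments.
Unset Strict Implicit.
Unset Printing Implicit Defensive.

Import Order.TTheory GRing.Theory Num.Theory.
Import numFieldNormedType.Exports.

Local Open Scope classical_set_scope.
Local Open Scope ring_scope.
Local Open Scope ereal_scope.

(** The degree of the root [- m.+1] counts the vertices [k.+1] whose step
    equals [(k + m).+2].  These events are independent, and because the steps
    have the same law their probabilities add up to the tail probability
    p_(m+2).  So every root degree is a sum of independent indicators whose
    mean is a tail of Z, and the whole statement is the Chernoff bound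
    P(S > x) <= (e q / x)^x for such a sum S of mean at most q.

    The Chernoff bound is first obtained for finitely many events.
    Exponentiating the count of the events A_i turns it into the product of
    the factors 1 + (e^s - 1) 1_(A_i), and expanding that product over subsets
    of indices reduces its expectation to the product rule for intersections
    ([expectation_prod_indic]); Markov's inequality then gives
    [chernoff_indic], the choice e^s = x / q gives the closed form
    ([chernoff_exponent_opt]), and continuity from below extends it to
    infinitely many events ([chernoff_indic_series]).

    The tail of the maximum follows from the union bound over the roots.
    As p_n <= 1, the probability that a root degree exceeds M is at most
    (e / M)^M for every root, and this tends to 0 as M grows: this is
    tightness. *)

(** * Chernoff's bound for independent events *)

Section chernoff.
Context {d : measure_display} {T : measurableType d} {R : realType}
  (P : probability T R).

(** The product rule over all finite subfamilies, for an index type that may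
    be infinite. *)
Definition independent_events (I : eqType) (A : I -> set T) : Prop :=
  forall s : seq I, uniq s ->
    P (\bigcap_(i in [set` s]) A i) = \prod_(i <- s) P (A i).

Lemma indic_bigcap (I : finType) (A : I -> set T) (J : {set I}) (w : T) :
  (\1_(\bigcap_(i in [set` J]) A i) w = \prod_(i in J) \1_(A i) w :> R)%R.
Proof.
rewrite indicE; have [wA|] := boolP (w \in _).
  rewrite big1// => i iJ; rewrite indicE mem_set//.
  by move/set_mem : wA; apply.
rewrite notin_setE => /existsNP[i /not_implyP[iJ /= wAi]].
by rewrite (bigD1 i)//= indicE memNset// mul0r.
Qed.

(** The product expands into a sum over the subsets J of indices, in which the
    term of J is c^#|J| times the indicator of an intersection, and
    independence gives the probability of that intersection. *)
Lemma expectation_prod_indic (I : finType) (A : I -> set T) (c : R) :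
    (0 <= c)%R -> (forall i, measurable (A i)) -> independent_events A ->
  \int[P]_w (\prod_i (1 + c * \1_(A i) w))%:E =
  (\prod_i (1 + c * fine (P (A i))))%:E.
Proof.
move=> c0 mA indA.
have mB (J : {set I}) : measurable (\bigcap_(i in [set` J]) A i).
  by apply: fin_bigcap_measurable => //; exact: finite_finset.
have expand (G : I -> R) : (\prod_i (1 + c * G i))%:E =
    \sum_(J : {set I}) ((c ^+ #|J|)%:E * (\prod_(i in J) G i)%:E).
  under eq_bigr do rewrite addrC.
  rewrite bigA_distr -sumEFin; apply: eq_bigr => J _.
  by rewrite -big_mkcond big_split/= prodr_const EFinM.
under eq_integral do rewrite expand.
rewrite ge0_integral_sum//; last 2 first.
- move=> J; apply/measurable_EFinP; apply: measurable_funM => //.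
  by under eq_fun do rewrite -indic_bigcap; exact: measurable_indic.
- by move=> J w _; rewrite -EFinM lee_fin mulr_ge0 ?exprn_ge0// prodr_ge0.
rewrite expand; apply: eq_bigr => J _.
under eq_integral do rewrite -indic_bigcap.
rewrite ge0_integralZl_EFin ?exprn_ge0//; last first.
  by apply/measurable_EFinP; exact: measurable_indic.
rewrite integral_indic// setIT; congr (_ * _).
rewrite -[in RHS]big_enum/= -prodEFin.
transitivity (\prod_(i <- enum J) P (A i)).
  rewrite -(indA _ (enum_uniq _)); congr (P (bigcap _ _)).
  by apply/seteqP; split => i /=; rewrite mem_enum.
by apply: eq_bigr => i _; rewrite fineK// fin_num_measure.
Qed.

Lemma measurable_count_gt (I : finType) (A : I -> set T) (x : R) :
    (forall i, measurable (A i)) ->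
  measurable [set w | (x < \sum_i \1_(A i) w)%R].
Proof.
move=> mA; rewrite (_ : [set w | _] =
    (fun w => \sum_i \1_(A i) w : R)%R @^-1` `]x, +oo[).
  rewrite -[X in measurable X]setTI.
  by apply: measurable_sum => // i; exact: measurable_indic.
by apply/seteqP; split => w /=; rewrite in_itv/= andbT.
Qed.

(** Markov's inequality for the exponential of the count, whose expectation is
    at most exp ((e^s - 1) q) because 1 + y <= exp y. *)
Lemma chernoff_indic (I : finType) (A : I -> set T) (s x q : R) :
    (0 <= s)%R -> (forall i, measurable (A i)) -> independent_events A ->
    \sum_i P (A i) <= q%:E ->
  P [set w | (x < \sum_i \1_(A i) w)%R] <=
  (expR (- (s * x)) * expR ((expR s - 1) * q))%:E.
Proof.
move=> s0 mA indA meanq.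
have c0 : (0 <= expR s - 1)%R by rewrite subr_ge0 -expR0 ler_expR.
have expR_count w : (expR (s * \sum_i \1_(A i) w) =
    \prod_i (1 + (expR s - 1) * \1_(A i) w))%R.
  rewrite mulr_sumr expR_sum; apply: eq_bigr => i _; rewrite indicE.
  by case: (w \in A i); rewrite ?mulr1 ?mulr0 ?expR0 ?addr0// addrC subrK.
set E := [set w | _].
have mE : measurable E by exact: measurable_count_gt.
have markov : (expR (s * x))%:E * P E <=
    \int[P]_w (\prod_i (1 + (expR s - 1) * \1_(A i) w))%:E.
  rewrite -[E in P E]setIT -integral_indic//.
  rewrite -ge0_integralZl_EFin ?expR_ge0//; last first.
    by apply/measurable_EFinP; exact: measurable_indic.
  apply: ge0_le_integral; first exact: measurableT.
  - by move=> w _; rewrite -EFinM lee_fin mulr_ge0 ?expR_ge0.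
  - by apply/measurable_EFinP; apply: measurable_funM.
  - apply/measurable_EFinP; apply: measurable_prod => i _.
    by apply: measurable_funD => //; apply: measurable_funM.
  move=> w _; rewrite -EFinM lee_fin -expR_count indicE.
  have [wE|_] := boolP (w \in E); last by rewrite mulr0 expR_ge0.
  by rewrite mulr1 ler_expR ler_wpM2l// ltW//; exact: set_mem wE.
have mgf : (\prod_i (1 + (expR s - 1) * fine (P (A i))) <=
    expR ((expR s - 1) * q))%R.
  apply: (@le_trans _ _ (\prod_i expR ((expR s - 1) * fine (P (A i))))%R).
    apply: ler_prod => i _; rewrite expR_ge1Dx andbT.
    by rewrite addr_ge0// mulr_ge0// fine_ge0.
  rewrite -expR_sum -mulr_sumr ler_expR ler_wpM2l//.
  rewrite -lee_fin -sumEFin; apply: le_trans meanq.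
  by apply: lee_sum => i _; rewrite fineK// fin_num_measure.
rewrite expRN EFinM lee_pdivlMl ?expR_gt0//.
by rewrite (le_trans markov)// expectation_prod_indic// lee_fin.
Qed.
End chernoff.

(** For 0 < q < x the best exponent satisfies e^s = x / q.  When x <= q the
    right-hand side is at least 1, and s = 0 gives p <= 1; when q = 0, letting s
    go to infinity forces p <= 0. *)
Lemma chernoff_exponent_opt (R : realType) (p x q : R) :
    (0 < x)%R -> (0 <= q)%R ->
    (forall s, (0 <= s)%R ->
      (p <= expR (- (s * x)) * expR ((expR s - 1) * q))%R) ->
  (p <= (expR 1 / x) `^ x * q `^ x)%R.
Proof.
move=> x0 q0 ple; have e0 := @expR_gt0 R 1.
have ex0 : (0 < expR 1 / x)%R by rewrite divr_gt0.
have p1 : (p <= 1)%R.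
  by have := ple 0%R (lexx _); rewrite expR0 mul0r subrr mul0r oppr0 expR0 mulr1.
have [qx|xq] := ltP q x; last first.
  apply: le_trans p1 _; rewrite -powRM ?(ltW ex0)//.
  rewrite -[leLHS](_ : 1 `^ x = 1)%R; last by rewrite powR1.
  apply: ge0_ler_powR; rewrite ?nnegrE ?(ltW x0)//.
  - by rewrite mulr_ge0 ?(ltW ex0).
  - rewrite mulrAC ler_pdivlMr// mul1r (le_trans xq)// ler_peMl//.
    by rewrite -expR0 ler_expR.
move: q0; rewrite le_eqVlt => /predU1P[q0|q0].
  rewrite -q0 powR0 ?gt_eqF// mulr0 leNgt; apply/negP => p0.
  (* this exponent makes exp (- s x) equal to p / 2 *)
  have := ple (- (ln (p / 2) / x))%R; rewrite -q0 mulr0 expR0 mulr1.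
  rewrite mulNr opprK divfK ?gt_eqF// lnK ?posrE ?divr_gt0//.
  have -> : (0 <= - (ln (p / 2) / x))%R.
    rewrite oppr_ge0 mulr_le0_ge0 ?invr_ge0 ?(ltW x0)// ln_le0//.
    by rewrite ler_pdivrMr// mul1r (le_trans p1)// ler1n.
  by move=> /(_ isT); rewrite leNgt ltr_pdivrMr// ltr_pMr// ltr1n.
have s0 : (0 <= ln (x / q))%R.
  by rewrite ln_ge0// ler_pdivlMr// mul1r ltW.
apply: le_trans (ple _ s0) _.
rewrite -powRM ?(ltW ex0) ?(ltW q0)//.
rewrite lnK ?posrE ?divr_gt0// mulrBl divfK ?gt_eqF// mul1r -expRD.
rewrite -(lnK (_ : (expR 1 / x * q)%R \is Num.pos)); last first.
  by rewrite posrE mulr_gt0 ?divr_gt0.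
rewrite -expRM ler_expR.
rewrite [ln (_ * q)]lnM ?posrE// !ln_div ?posrE// expRK.
lra.
Qed.

Section chernoff_series.
Context {d : measure_display} {T : measurableType d} {R : realType}
  (P : probability T R).

(** Only the partial sums of the probabilities are controlled, and the bound
    does not depend on their length, so it passes to the limit along the
    increasing events that a partial count exceeds x. *)
Lemma chernoff_indic_series (A : nat -> set T) (x q : R) :
    (0 < x)%R -> (0 <= q)%R ->
    (forall i, measurable (A i)) -> independent_events P A ->
    (forall n, \sum_(i < n) P (A i) <= q%:E) ->
  P [set w | x%:E < \sum_(0 <= i <oo) (\1_(A i) w)%:E] <=
  ((expR 1 / x) `^ x * q `^ x)%:E.
Proof.
move=> x0 q0 mA indA meanq.
pose E n := [set w | (x < \sum_(i < n) \1_(A i) w)%R].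
have mE n : measurable (E n) by exact: measurable_count_gt.
have partial_sumE n w : \sum_(0 <= i < n) (\1_(A i) w)%:E =
    (\sum_(i < n) \1_(A i) w : R)%:E by rewrite big_mkord sumEFin.
have -> : [set w | x%:E < \sum_(0 <= i <oo) (\1_(A i) w)%:E] = \bigcup_n E n.
  apply/seteqP; split => w /= => [xlt|[n _ xlt]].
    apply: contrapT => notE; move: xlt; apply/negP; rewrite -leNgt.
    apply: lime_le; first by apply: is_cvg_nneseries => i _ _; rewrite lee_fin.
    apply: nearW => n; rewrite partial_sumE lee_fin leNgt; apply/negP => xlt.
    by apply: notE; exists n.
  apply: (@lt_le_trans _ _ (\sum_(0 <= i < n) (\1_(A i) w)%:E)).
    by rewrite partial_sumE lte_fin.
  by apply: nneseries_lim_ge => i _ _; rewrite lee_fin.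
have cvgE : P (E n) @[n --> \oo] --> P (\bigcup_n E n).
  apply: nondecreasing_cvg_mu => //; first exact: bigcup_measurable.
  move=> m n mn; apply/subsetPset => w /= /lt_le_trans; apply.
  rewrite -lee_fin -!partial_sumE.
  by apply: lee_sum_nneg_natr => // i _ _; rewrite lee_fin.
rewrite -(cvg_lim _ cvgE)//.
apply: lime_le; first by apply/cvg_ex; exists (P (\bigcup_n E n)).
apply: nearW => n.
rewrite -[P _]fineK ?fin_num_measure// lee_fin.
apply: chernoff_exponent_opt => // s s0.
rewrite -lee_fin fineK ?fin_num_measure//.
apply: chernoff_indic => // t uniqt.
rewrite -(big_map val xpredT (P \o A))/= -indA ?map_inj_uniq//;
  last exact: val_inj.
congr (P _); apply/seteqP; split => w /= wA i.
  by move=> /mapP[j jt ->]; exact: wA.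
by move=> it; apply: wA; rewrite /= map_f.
Qed.
End chernoff_series.

(** * Degrees of the negative roots *)

Section root_degree.
Context {d : measure_display} {T : measurableType d} {R : realType}
  (P : probability T R) (Z : nat -> {RV P >-> nat}).

(** The event that the vertex [k.+1] is a child of the root
    [Negz m = - m.+1]. *)
Definition child_event (m k : nat) : set T :=
  Z k.+1 @^-1` [set (k + m).+2].

Lemma outdegree_root (m : nat) (w : T) :
  outdegree Z (Negz m) w = \sum_(0 <= k <oo) (\1_(child_event m k) w)%:E.
Proof.
rewrite /outdegree (_ : absz _ = 1%N); last by rewrite NegzE; lia.
rewrite -(@nneseries_addn _ _ 1); last by move=> k; rewrite lee_fin.
apply: eq_eseriesr => k _; congr _%:E; rewrite indicE addn1.
congr (_%:R)%R; congr nat_of_bool; apply/eqP/idP => [par|/set_mem/= par].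
  by apply/mem_set; rewrite /child_event /= ; move: par; rewrite /parent; lia.
by rewrite /parent par; lia.
Qed.

Lemma measurable_child_event (m k : nat) : measurable (child_event m k).
Proof. by rewrite -[child_event m k]setTI; exact: measurable_funPT. Qed.

Lemma measurable_tail (n : nat) : measurable [set w | (n <= Z 0%N w)%N].
Proof.
rewrite (_ : [set w | _] = setT `&` Z 0%N @^-1` [set j | (n <= j)%N]).
  exact: measurable_funPT.
by rewrite setTI.
Qed.

Lemma tail_prob_le (m n : nat) : (m <= n)%N -> tail_prob Z n <= tail_prob Z m.
Proof.
move=> mn; apply: le_measure; rewrite ?inE; try exact: measurable_tail.
by move=> w /=; exact: leq_trans.
Qed.

Context (Ziid : iid Z).

Lemma independent_child_event (m : nat) :
  independent_events P (child_event m).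
Proof.
move=> s uniqs; have [indZ _] := Ziid.
have := indZ (map S s) (fun t => [set (t + m).+1]).
rewrite map_inj_uniq; last exact: succn_inj.
move=> /(_ uniqs (fun=> I)); rewrite big_map => <-.
congr (P _); apply/seteqP; split => w /= wA i.
  by move=> /mapP[j js ->]; exact: wA.
by move=> js; apply: (wA i.+1); rewrite /= map_f.
Qed.

(** Replacing every step by the generic copy [Z 0] turns the events into
    disjoint ones, all contained in the event that [Z 0 >= m.+2]. *)
Lemma mean_outdegree_root_le (m n : nat) :
  \sum_(k < n) P (child_event m k) <= tail_prob Z m.+2.
Proof.
have same k : P (child_event m k) = P (Z 0%N @^-1` [set (k + m).+2]).
  by have [_ idZ] := Ziid; exact: (idZ k.+1 0%N).
under eq_bigr do rewrite same.
have mZ0 k : measurable (Z 0%N @^-1` [set (k + m).+2]).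
  by rewrite -[X in measurable X]setTI; exact: measurable_funPT.
have disj : trivIset setT (fun k => Z 0%N @^-1` [set (k + m).+2]).
  by move=> i j _ _ [w [/= ->]]; lia.
rewrite -(measure_bigsetU P mZ0 disj).
rewrite -(bigcup_mkord n (fun k => Z 0%N @^-1` [set (k + m).+2])).
apply: le_measure; rewrite ?inE.
- exact: bigcup_measurable.
- exact: measurable_tail.
- by move=> w [k _ /= ->]; lia.
Qed.

Lemma outdegree_root_tail (m : nat) (x : R) : (0 < x)%R ->
  P [set w | x%:E < outdegree Z (Negz m) w] <=
  ((expR 1 / x) `^ x)%:E * tail_prob Z m.+2 `^ x.
Proof.
move=> x0.
have tail_fin : tail_prob Z m.+2 \is a fin_num.
  by rewrite fin_num_measure//; exact: measurable_tail.
have -> : [set w | x%:E < outdegree Z (Negz m) w] =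
    [set w | x%:E < \sum_(0 <= k <oo) (\1_(child_event m k) w)%:E].
  by apply/seteqP; split => w /=; rewrite outdegree_root.
rewrite -(fineK tail_fin) poweR_EFin -EFinM.
apply: chernoff_indic_series => //.
- by rewrite fine_ge0// measure_ge0.
- exact: measurable_child_event.
- exact: independent_child_event.
- by move=> n; rewrite fineK//; exact: mean_outdegree_root_le.
Qed.

End root_degree.

(** * Tightness and the maximal root degree *)

Theorem proposition4 (d : measure_display) (T : measurableType d)
    (R : realType) (P : probability T R) (Z : nat -> {RV P >-> nat})
    (Zpos : forall n w, (0 < Z n w)%N) (Ziid : iid Z)
    (lambda : R) (lambda_gt0 : (0 < lambda)%R)
    (summable_tail : \sum_(1 <= n <oo) tail_prob Z n `^ lambda < +oo) :
  tight P [set i : int | (i < 0)%R] (outdegree Z) /\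
  (forall x : R, (lambda <= x)%R ->
    P [set w | x%:E < ereal_sup [set outdegree Z i w | i in [set i : int | (i < 0)%R]]]
    <= ((expR 1 / x) `^ x)%:E * \sum_(1 <= n <oo) tail_prob Z n `^ x).
Proof.
have neg_int (i : int) : (i < 0)%R -> i = Negz (absz i).-1 by case: i.
have poweR_tail_le (m n : nat) (x : R) : (0 < x)%R -> (m <= n)%N ->
    tail_prob Z n `^ x <= tail_prob Z m `^ x.
  move=> x0 mn; apply: gt0_ler_poweR; first exact: ltW.
  - by rewrite in_itv/= measure_ge0 leey.
  - by rewrite in_itv/= measure_ge0 leey.
  - exact: tail_prob_le.
split=> [eps eps0|x lex].
  have e1 : (1 <= expR 1 :> R)%R by rewrite -expR0 ler_expR.
  (* M >= e / eps and M >= e give (e / M)^M <= e / M <= eps *)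
  pose M := Num.max (expR 1) (expR 1 / eps)%R.
  have M1 : (1 <= M)%R by rewrite le_max e1.
  have M0 : (0 < M)%R by exact: lt_le_trans M1.
  exists M => i /= /neg_int ->.
  have abs_outdegree w : `|outdegree Z (Negz (absz i).-1) w| =
      outdegree Z (Negz (absz i).-1) w.
    by rewrite gee0_abs// nneseries_ge0// => k _ _; rewrite lee_fin.
  under eq_set do rewrite abs_outdegree.
  apply: le_trans (outdegree_root_tail Ziid _ M0) _.
  apply: (@le_trans _ _ ((expR 1 / M) `^ M)%:E).
    rewrite -[leRHS]mule1 lee_wpmul2l ?lee_fin ?powR_ge0//.
    rewrite (le_trans (poweR_tail_le 0%N _ _ M0 (leq0n _)))//.
    rewrite [X in X `^ _](_ : _ = 1) ?poweR1r//.
    by rewrite /tail_prob -[RHS](probability_setT P); congr (P _); apply/seteqP.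
  rewrite lee_fin; apply: (@le_trans _ _ (expR 1 / M)%R).
    rewrite ge1r_powR// divr_gt0 ?expR_gt0//= ler_pdivrMr// mul1r.
    by rewrite le_max lexx.
  by rewrite ler_pdivrMr// mulrC -ler_pdivrMr// le_max lexx orbT.
have x0 : (0 < x)%R by exact: lt_le_trans lex.
pose F m := [set w | x%:E < outdegree Z (Negz m) w].
have mF m : measurable (F m).
  rewrite /F -[X in measurable X]setTI.
  by apply: emeasurable_fun_o_infty => //; exact: measurable_outdegree.
have -> : [set w | x%:E < ereal_sup
    [set outdegree Z i w | i in [set i : int | (i < 0)%R]]] = \bigcup_m F m.
  apply/seteqP; split => w /= => [/ereal_sup_gt[_ [i /= i0 <-]] xlt|[m _ xlt]].
    by exists (absz i).-1 => //; rewrite /F/= -neg_int.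
  by apply: (lt_le_trans xlt); apply: ereal_sup_ubound; exists (Negz m).
apply: (@le_trans _ _ (\sum_(0 <= m <oo) P (F m))).
  by apply: measure_sigma_subadditive => //; exact: bigcup_measurable.
(* the root - m.+1 contributes p_(m+2) <= p_(m+1) *)
rewrite -(@nneseries_addn _ _ 1); last by move=> k; exact: poweR_ge0.
rewrite -nneseriesZl; last by move=> k _; exact: poweR_ge0.
apply: lee_nneseries => // m _.
apply: le_trans (outdegree_root_tail Ziid _ x0) _.
by rewrite lee_wpmul2l ?lee_fin ?powR_ge0// poweR_tail_le// addn1.
Qed.
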